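(* Let $f:\mathbb{R}\to\mathbb{R}$ be a function, let $I$ be an open interval of $\mathbb{R}$, and let $x\in I$. Then: (i) $f$ is upper semi-continuous at $x$ (that is, $f(x)=f^{\ast}(x)$) if and only if $$\forall \varepsilon>0,\ \exists \eta>0,\ \forall y\in\mathbb{R}:\quad (|y-x|<\eta \text{ and } y\in I)\Longrightarrow f(y)\le f(x)+\varepsilon .$$ (ii) $f$ is lower semi-continuous at $x$ (that is, $f(x)=f_{\ast}(x)$) if and only if $$\forall \varepsilon>0,\ \exists \eta>0,\ \forall y\in\mathbb{R}:\quad (|y-x|<\eta \text{ and } y\in I)\Longrightarrow f(x)-\varepsilon\le f(y).$$
   Context: For a function $f:\mathbb{R}\to\mathbb{R}$ and $x\in\mathbb{R}$, define in $\overline{\mathbb{R}}=[-\infty,+\infty]$ $$f^{\ast}(x)=\lim_{\varepsilon\downarrow 0}\sup\{f(y): y\in\,]x-\varepsilon,x+\varepsilon[\},\qquad f_{\ast}(x)=\lim_{\varepsilon\downarrow 0}\inf\{f(y): y\in\,]x-\varepsilon,x+\varepsilon[\}.$$ The point $y=x$ is included in the supremum and infimum, and the limits exist by monotonicity in $\varepsilon$. The notation $]a,b[$ denotes the open interval. The function $f$ is upper semi-continuous at $x$ if $f(x)=f^{\ast}(x)$, and lower semi-continuous at $x$ if $f(x)=f_{\ast}(x)$. *)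

(* Defs.v *)
From mathcomp Require Import all_boot all_order all_algebra.
From mathcomp Require Import all_classical all_reals all_analysis.

Set Implicit Arguments.
Unset Strict Implicit.
Unset Printing Implicit Defensive.

Import Order.TTheory GRing.Theory Num.Theory.
Import numFieldNormedType.Exports.

Local Open Scope classical_set_scope.
Local Open Scope ring_scope.

Definition sup_near (R : realType) (f : R -> R) (x e : R) : \bar R :=
  ereal_sup [set (f y)%:E | y in `]x - e, x + e[%classic].

Definition inf_near (R : realType) (f : R -> R) (x e : R) : \bar R :=
  ereal_inf [set (f y)%:E | y in `]x - e, x + e[%classic].

Definition upper_envelope (R : realType) (f : R -> R) (x : R) : \bar R :=
  lim (sup_near f x e @[e --> 0^'+]).

Definition lower_envelope (R : realType) (f : R -> R) (x : R) : \bar R :=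
  lim (inf_near f x e @[e --> 0^'+]).

(* [lim] is a total operator, so [upper_envelope] and [lower_envelope] are
   meaningful only because these limits exist. *)
Lemma is_cvg_sup_near (R : realType) (f : R -> R) (x : R) :
  cvg (sup_near f x e @[e --> 0^'+]).
Proof.
apply: (@nondecreasing_at_right_is_cvge _ _ 0); near=> b.
move=> e e' _ _ ee'; apply: ereal_sup_le => _ [y /= yx <-].
exists y => //=; move: yx; rewrite !in_itv/= => /andP[y1 y2].
by rewrite (le_lt_trans _ y1) ?lerB// (lt_le_trans y2) ?lerD2l.
Unshelve. all: by end_near. Qed.

Lemma is_cvg_inf_near (R : realType) (f : R -> R) (x : R) :
  cvg (inf_near f x e @[e --> 0^'+]).
Proof.
apply: (@nonincreasing_at_right_is_cvge _ _ 0); near=> b.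
move=> e e' _ _ ee'; apply: ereal_inf_le_tmp => _ [y /= yx <-].
exists y => //=; move: yx; rewrite !in_itv/= => /andP[y1 y2].
by rewrite (le_lt_trans _ y1) ?lerB// (lt_le_trans y2) ?lerD2l.
Unshelve. all: by end_near. Qed.

Definition upper_semicontinuous_at (R : realType) (f : R -> R) (x : R) : Prop :=
  (f x)%:E = upper_envelope f x.

Definition lower_semicontinuous_at (R : realType) (f : R -> R) (x : R) : Prop :=
  (f x)%:E = lower_envelope f x.

(* Main.v *)
(* The supremum of [f] over ]x - e, x + e[ is monotone in [e], so [f^*(x)] is its
   infimum over [e > 0], and [f^*(x) >= f(x)] always. Hence [f^*(x) = f(x)] says
   that these suprema come arbitrarily close to [f(x)]; openness of [I] makes the
   restriction to [I] harmless. Part (ii) is part (i) for [-f]. *)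
Require Import Defs.
From mathcomp Require Import all_boot all_order all_algebra.
From mathcomp Require Import all_classical all_reals all_analysis.

Import Order.TTheory GRing.Theory Num.Theory.
Import numFieldNormedType.Exports.

Local Open Scope classical_set_scope.
Local Open Scope ring_scope.

Lemma itvoo_distE (R : realType) (x e y : R) :
  (y \in `]x - e, x + e[) = (`|y - x| < e).
Proof. by rewrite in_itv/= distrC ltr_distlC. Qed.

Lemma le_sup_near (R : realType) (f : R -> R) (x e y : R) :
  `|y - x| < e -> ((f y)%:E <= sup_near f x e)%E.
Proof.
by move=> yx; apply: ereal_sup_ubound; exists y; rewrite //= itvoo_distE.
Qed.

(** The point [x] lies in every interval of positive radius around it, so each supremum, and hence
    their limit, dominates [f x]. *)
Lemma le_upper_envelope (R : realType) (f : R -> R) (x : R) :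
  ((f x)%:E <= upper_envelope f x)%E.
Proof.
apply: lime_ge; first exact: is_cvg_sup_near.
near=> e; apply: le_sup_near; rewrite subrr normr0.
by near: e; exact: nbhs_right_gt.
Unshelve. all: by end_near. Qed.

(** Once the radius [d] is at most [e], the supremum runs over a smaller interval; the bound passes
    to the limit. *)
Lemma upper_envelope_le_sup_near (R : realType) (f : R -> R) (x e : R) :
  0 < e -> (upper_envelope f x <= sup_near f x e)%E.
Proof.
move=> e0; apply: lime_le; first exact: is_cvg_sup_near.
near=> d; apply: ge_ereal_sup => _ [y /= + <-]; rewrite itvoo_distE => yd.
apply: le_sup_near; apply: (lt_le_trans yd).
by near: d; exact: nbhs_right_le.
Unshelve. all: by end_near. Qed.

(** By contraposition: if the suprema at all positive radii were at least [c], so would be their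
    limit. *)
Lemma sup_near_lt_upper_envelope (R : realType) (f : R -> R) (x : R)
    (c : \bar R) : (upper_envelope f x < c)%E ->
  exists2 e : R, 0 < e & (sup_near f x e < c)%E.
Proof.
move=> Lc; apply: contrapT => H; move: Lc; apply/negP; rewrite -leNgt.
apply: lime_ge; first exact: is_cvg_sup_near.
near=> e; have e0 : 0 < e by near: e; exact: nbhs_right_gt.
by rewrite leNgt; apply/negP => ec; apply: H; exists e.
Unshelve. all: by end_near. Qed.

Lemma upper_semicontinuous_atP (R : realType) (f : R -> R) (I : set R) (x : R) :
  open I -> I x ->
  upper_semicontinuous_at f x <->
    (forall eps : R, 0 < eps -> exists2 eta : R, 0 < eta &
       forall y : R, `|y - x| < eta /\ I y -> f y <= f x + eps).
Proof.
move=> I_open xI; split => [fx eps eps0|H].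
  (* The slack [eps] makes the envelope strictly less than [f x + eps]; the radius obtained serves
     as [eta]. *)
  have [|eta eta0 supfx] := sup_near_lt_upper_envelope _ f x (f x + eps)%:E.
    by rewrite -fx lte_fin ltrDl.
  exists eta => // y [yx _]; rewrite -lee_fin.
  exact: le_trans (le_sup_near _ _ _ _ _ yx) (ltW supfx).
apply/eqP; rewrite eq_le le_upper_envelope/=.
apply/lee_addgt0Pr => eps eps0; have [eta eta0 fle] := H _ eps0.
(* Choose [e] below [eta] and so small that the whole interval lies in [I]: then [fle] bounds [f] at
   each of its points. *)
near (0 : R)^'+ => e.
have e0 : 0 < e by near: e; exact: nbhs_right_gt.
have e_eta : e <= eta by near: e; exact: nbhs_right_le.
have eI : `]x - e, x + e[ `<=` I by near: e; exact: open_itvoo_subset.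
apply: le_trans (upper_envelope_le_sup_near _ _ _ _ e0) _.
apply: ge_ereal_sup => _ [y /= yx <-]; rewrite -EFinD lee_fin.
apply: fle; split; last exact: eI.
by rewrite itvoo_distE in yx; exact: lt_le_trans e_eta.
Unshelve. all: by end_near. Qed.

Lemma inf_nearN (R : realType) (f : R -> R) (x e : R) :
  inf_near f x e = (- sup_near (\- f)%R x e)%E.
Proof. by rewrite /inf_near ereal_infEN image_comp. Qed.

(** Negation is continuous on the extended reals, so it commutes with the limit, which exists by
    [is_cvg_sup_near]. *)
Lemma lower_envelopeN (R : realType) (f : R -> R) (x : R) :
  lower_envelope f x = (- upper_envelope (\- f)%R x)%E.
Proof.
rewrite -limeN; last exact: is_cvg_sup_near.
by rewrite /lower_envelope (funext (inf_nearN _ f x)).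
Qed.

Lemma lower_semicontinuous_atN (R : realType) (f : R -> R) (x : R) :
  lower_semicontinuous_at f x <-> upper_semicontinuous_at (\- f) x.
Proof.
rewrite /lower_semicontinuous_at /upper_semicontinuous_at lower_envelopeN EFinN.
by split => [->|<-]; rewrite oppeK.
Qed.

Theorem proposition1 (R : realType) (f : R -> R) (I : set R)
    (I_open : open I) (I_itv : is_interval I) (x : R) (xI : I x) :
  (upper_semicontinuous_at f x <->
     (forall eps : R, 0 < eps -> exists2 eta : R, 0 < eta &
        forall y : R, `|y - x| < eta /\ I y -> f y <= f x + eps)) /\
  (lower_semicontinuous_at f x <->
     (forall eps : R, 0 < eps -> exists2 eta : R, 0 < eta &
        forall y : R, `|y - x| < eta /\ I y -> f x - eps <= f y)).
Proof.
split; first exact: upper_semicontinuous_atP.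
(* Negating both sides turns the criterion for [\- f] into the one for [f], with the same [eta]. *)
have leN (eps y : R) : ((\- f) y <= (\- f) x + eps) = (f x - eps <= f y).
  by rewrite /= -[in LHS]lerN2 opprK opprD opprK.
rewrite lower_semicontinuous_atN (upper_semicontinuous_atP _ _ _ _ I_open xI).
by split=> H eps /H[eta eta0 Heta]; exists eta => // y /Heta; rewrite leN.
Qed.
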